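(* Let $G=(V,E)$ be a series-parallel digraph with a multiflow instance given by commodities $i\in[k]$ with source-sink pairs $(s_i,t_i)$, demands $d_i$, and arc capacities $(c_e)_{e\in E}$. There exists a feasible multiflow if and only if the strengthened cut condition $$c\bigl(\delta^+(X)\bigr)\ge\sum_{i\in K(\delta^+(X))}d_i\qquad\text{for all } X\subseteq V$$ holds.
   Context: Digraphs may have parallel arcs. A digraph $G=(V,E)$ is series-parallel if it has a designated start node $u_0$ and end node $v_0$ such that one of the following (recursively) holds: (1) $G$ consists of a single arc from $u_0$ to $v_0$; (2) (series composition) there are series-parallel digraphs $G_1=(V_1,E_1)$, $G_2=(V_2,E_2)$ with start/end nodes $u_1,v_1$ and $u_2,v_2$ such that $V=V_1\cup V_2$, $E$ is the disjoint union of $E_1$ and $E_2$, $u_0=u_1$, $v_1=u_2$, $v_0=v_2$, $V_1\cap V_2=\{v_1\}$; (3) (parallel composition) there are such $G_1,G_2$ with $V=V_1\cup V_2$, $E$ the disjoint union of $E_1$ and $E_2$, $u_0=u_1=u_2$, $v_0=v_1=v_2$, $V_1\cap V_2=\{u_0,v_0\}$. A multiflow instance on $G$ consists of $k$ commodities $i\in[k]=\{1,\dots,k\}$ with source-sink pairs $(s_i,t_i)\in V\times V$ and real demands $d_i>0$, where $s_i\ne t_i$ and $G$ contains an $s_i$–$t_i$ path for each $i$. A multiflow consists of values $X_{e,i}\ge0$ ($e\in E$, $i\in[k]$) such that for all $v\in V$, $i\in[k]$, $\sum_{e\in\delta^+(v)}X_{e,i}-\sum_{e\in\delta^-(v)}X_{e,i}$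 equals $d_i$ if $v=s_i$, $-d_i$ if $v=t_i$, and $0$ otherwise ($\delta^+(v),\delta^-(v)$ are the sets of arcs leaving and entering $v$). Given arc capacities $c_e\ge0$, it is feasible if $\sum_{i\in[k]}X_{e,i}\le c_e$ for all $e\in E$. For $X\subseteq V$, $\delta^+(X)$ is the set of arcs with tail in $X$ and head in $V\setminus X$. For $F\subseteq E$, $c(F)=\sum_{e\in F}c_e$ and $K(F)=\{i\in[k] : \text{there is no } s_i\text{–}t_i \text{ path in } (V,E\setminus F)\}$. *)

(* Defs.v *)
From HB Require Import structures.
From mathcomp Require Import all_boot all_order all_algebra.
From mathcomp Require Import reals.
Set Implicit Arguments.
Unset Strict Implicit.
Unset Printing Implicit Defensive.
Import Order.TTheory GRing.Theory Num.Theory.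
Local Open Scope ring_scope.

(* Arcs form a type of their own, so that parallel arcs are allowed. *)
Record digraph := Digraph {
  node : finType;
  edge : finType;
  arc_tail : edge -> node;
  arc_head : edge -> node
}.

(* [series_parallel_sub VS ES u v]: the sub-digraph of G with node set VS and
   arc set ES is series-parallel with start node u and end node v.  In the
   recursive cases the two components are sub-digraphs of G, so that the unions
   and intersections of their node and arc sets are those of {set _}. *)
Inductive series_parallel_sub (G : digraph) :
    {set node G} -> {set edge G} -> node G -> node G -> Prop :=
| SPArc (e : edge G) :
    series_parallel_sub [set arc_tail e; arc_head e] [set e]
      (arc_tail e) (arc_head e)
| SPSeries (V1 V2 : {set node G}) (E1 E2 : {set edge G}) (u w v : node G) :
    series_parallel_sub V1 E1 u w ->
    series_parallel_sub V2 E2 w v ->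
    [disjoint E1 & E2] ->
    V1 :&: V2 = [set w] ->
    series_parallel_sub (V1 :|: V2) (E1 :|: E2) u v
| SPParallel (V1 V2 : {set node G}) (E1 E2 : {set edge G}) (u v : node G) :
    series_parallel_sub V1 E1 u v ->
    series_parallel_sub V2 E2 u v ->
    [disjoint E1 & E2] ->
    V1 :&: V2 = [set u; v] ->
    series_parallel_sub (V1 :|: V2) (E1 :|: E2) u v.

Definition series_parallel (G : digraph) : Prop :=
  exists u0 v0 : node G, series_parallel_sub [set: node G] [set: edge G] u0 v0.

Definition arc_rel (G : digraph) (F : {set edge G}) : rel (node G) :=
  [rel x y | [exists e in F, (arc_tail e == x) && (arc_head e == y)]].

Definition has_path (G : digraph) (F : {set edge G}) (x y : node G) : bool :=
  connect (arc_rel F) x y.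

Definition out_cut (G : digraph) (X : {set node G}) : {set edge G} :=
  [set e | (arc_tail e \in X) && (arc_head e \notin X)].

Definition separated (G : digraph) (k : nat) (s t : 'I_k -> node G)
    (F : {set edge G}) : {set 'I_k} :=
  [set i | ~~ has_path (~: F) (s i) (t i)].

(* A loop at v is counted as both leaving and entering v, hence contributes
   nothing to the difference. *)
Definition multiflow (R : realType) (G : digraph) (k : nat)
    (s t : 'I_k -> node G) (d : 'I_k -> R) (X : edge G -> 'I_k -> R) : Prop :=
  (forall e i, 0 <= X e i) /\
  (forall v i,
     \sum_(e | arc_tail e == v) X e i - \sum_(e | arc_head e == v) X e i
     = if v == s i then d i else if v == t i then - d i else 0).

Definition feasible (R : realType) (G : digraph) (k : nat) (c : edge G -> R)
    (X : edge G -> 'I_k -> R) : Prop :=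
  forall e, \sum_(i < k) X e i <= c e.

Definition strengthened_cut_condition (R : realType) (G : digraph) (k : nat)
    (s t : 'I_k -> node G) (d : 'I_k -> R) (c : edge G -> R) : Prop :=
  forall X : {set node G},
    \sum_(e in out_cut X) c e >= \sum_(i in separated s t (out_cut X)) d i.

(* Main.v *)
Require Import Defs.
From HB Require Import structures.
From mathcomp Require Import all_boot all_order all_algebra.
From mathcomp Require Import reals.
From mathcomp Require Import ring lra.
Set Implicit Arguments.
Unset Strict Implicit.
Unset Printing Implicit Defensive.
Import Order.TTheory GRing.Theory Num.Theory.
Local Open Scope ring_scope.

(* For a component with terminals u and v, call an out-cut X inner if u \in X
   implies v \in X, and crossing if it contains u but not v.  By induction on the
   series-parallel construction, the commodities inside a component can be routed
   as soon as (a) every inner cut has enough capacity for the commodities other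
   than (u,v) that it separates, and (b) every crossing cut has enough capacity
   for all the commodities that it separates.  In a series composition a commodity
   that passes the middle node w is split at w.  In a parallel composition only
   the (u,v)-demand has to be distributed over the two sides; crossing cuts of the
   two sides can be chosen independently, so a suitable ratio exists provided that
   on each side the residual capacity of a crossing cut, after serving the
   commodities other than (u,v), is nonnegative.  The latter follows from (a)
   alone: at a series composition, a crossing cut is a disjoint union of two
   inner cuts. *)

(** * Reachability and digraphs with two terminals *)

Section Reachability.
Variable G : digraph.
Implicit Types (A B E F : {set edge G}) (S X V : {set node G}) (x y : node G).

(** Serves two purposes: with [f] the identity it compares arc sets, also up to loops; with [f] a
    contraction it projects a path onto one side of a series composition. *)
Lemma has_path_map A B (f : node G -> node G) x y :
  (forall e, e \in A -> has_path B (f (arc_tail e)) (f (arc_head e))) ->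
  has_path A x y -> has_path B (f x) (f y).
Proof.
move=> AB /connectP[p + ->]; elim: p x => [|z p IH] x /=; first by rewrite /has_path connect0.
case/andP=> /exists_inP[e eA /andP[/eqP <- /eqP <-]] /IH; exact/connect_trans/AB.
Qed.

Lemma has_path_arc A e : e \in A -> has_path A (arc_tail e) (arc_head e).
Proof. by move=> eA; apply/connect1/exists_inP; exists e; rewrite ?eqxx. Qed.

Lemma has_pathS A B x y : A \subset B -> has_path A x y -> has_path B x y.
Proof.
by move=> /subsetP AB; apply: (@has_path_map _ _ id) => e /AB; apply: has_path_arc.
Qed.

Lemma has_path_refl A x : has_path A x x.
Proof. exact: connect0. Qed.

Lemma has_path_trans A y x z : has_path A x y -> has_path A y z -> has_path A x z.
Proof. exact: connect_trans. Qed.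

Lemma has_path_closed A (P : pred (node G)) x y :
  (forall e, e \in A -> P (arc_tail e) -> P (arc_head e)) ->
  has_path A x y -> P x -> P y.
Proof.
move=> AP /connectP[p + ->]; elim: p x => [|z p IH] x //=.
case/andP=> /exists_inP[e eA /andP[/eqP <- /eqP <-]] /IH pz /(AP _ eA).
exact: pz.
Qed.

(** Once the out-cut is removed, no remaining arc leaves [X]. *)
Lemma out_cut_separates E X x y :
  x \in X -> y \notin X -> ~~ has_path (E :\: (E :&: out_cut X)) x y.
Proof.
move=> xX; apply: contra => /has_path_closed -/(_ [in X]); apply=> // e.
by rewrite !inE => /andP[+ eE] tX; rewrite eE tX /= negbK.
Qed.

(** What the induction keeps of a series-parallel component once loops are removed. As no arc enters
    [u] or leaves [v], a path meets [u] only at its start and [v] only at its end. *)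
Record two_terminal V E (u v : node G) : Prop := TwoTerminal {
  tt_neq : u != v;
  tt_start : u \in V;
  tt_end : v \in V;
  tt_tail : forall e, e \in E -> arc_tail e \in V;
  tt_head : forall e, e \in E -> arc_head e \in V;
  tt_source : forall e, e \in E -> arc_head e != u;
  tt_sink : forall e, e \in E -> arc_tail e != v;
  tt_path : has_path E u v
}.

Lemma has_path_to_start V E u v A x :
  two_terminal V E u v -> A \subset E -> has_path A x u -> x = u.
Proof.
move=> tt /subsetP AE; case: (eqVneq x u) => // xu xpu.
have := has_path_closed _ xpu (P := [pred y | y != u]).
by rewrite /= eqxx => H; suff: false by []; apply: H => // e /AE /(tt_source tt).
Qed.

Lemma has_path_from_end V E u v A y :
  two_terminal V E u v -> A \subset E -> has_path A v y -> y = v.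
Proof.
move=> tt /subsetP AE vy; apply/eqP.
apply: (has_path_closed _ vy (P := pred1 v)) => /= [e|]; last exact: eqxx.
by move=> /AE /(tt_sink tt) /negPf->.
Qed.

Lemma two_terminal_arc e : arc_tail e != arc_head e ->
  two_terminal [set arc_tail e; arc_head e] [set e] (arc_tail e) (arc_head e).
Proof.
move=> te; split=> //; rewrite ?inE ?eqxx ?orbT //; last by rewrite has_path_arc ?set11.
- by move=> f /set1P->; rewrite !inE eqxx.
- by move=> f /set1P->; rewrite !inE eqxx orbT.
- by move=> f /set1P->; rewrite eq_sym.
- by move=> f /set1P->.
Qed.

Lemma has_path_set1 e x y : has_path [set e] x y ->
  x = y \/ x = arc_tail e /\ y = arc_head e.
Proof.
move=> xy; case: (eqVneq x y) => [|nxy]; [by left | right].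
have xt : x = arc_tail e.
  apply/eqP; apply: contraNT nxy => xt; rewrite eq_sym.
  apply: (has_path_closed _ xy (P := pred1 x)) => //= f /set1P->.
  by rewrite eq_sym (negPf xt).
split=> //; subst x; move: nxy; rewrite eq_sym => /negPf nxy.
have := has_path_closed _ xy (P := pred2 (arc_tail e) (arc_head e)).
rewrite /= eqxx nxy => H; apply/eqP/H => // f /set1P->; by rewrite !eqxx orbT.
Qed.

End Reachability.

(** * Paths and cuts in a series composition *)

(** The set puts all of [V2] on the side of [w], so no arc of [E2] is cut. The terminals are kept
    arbitrary so that the two components can be exchanged. *)
Lemma series_cut (G : digraph) (V1 V2 : {set node G}) (E1 E2 : {set edge G})
    u1 v1 u2 v2 w (X : {set node G}) :
  two_terminal V1 E1 u1 v1 -> two_terminal V2 E2 u2 v2 -> V1 :&: V2 = [set w] ->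
  (E1 :|: E2) :&: out_cut (if w \in X then X :&: V1 :|: V2 else X :&: V1)
  = E1 :&: out_cut X.
Proof.
move=> tt1 tt2 VI; set Y := if _ then _ else _.
have Y1 x : x \in V1 -> (x \in Y) = (x \in X).
  move=> x1; have/setP/(_ x) := VI; rewrite /Y 2!inE x1 => /= x2.
  case: ifP => wX; rewrite !inE x1 andbT // x2.
  by case: eqVneq => [->|]; rewrite ?wX ?orbF.
have Y2 x : x \in V2 -> (x \in Y) = (w \in X).
  move=> x2; have/setP/(_ x) := VI; rewrite /Y 2!inE x2 andbT => /= x1.
  case: ifP => wX; rewrite !inE x1 ?x2 ?orbT //.
  by case: eqVneq => [->|]; rewrite ?wX ?andbF.
apply/setP=> e; rewrite !inE.
case e1: (e \in E1) => /=; first by rewrite !Y1 ?(tt_tail tt1) ?(tt_head tt1).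
case e2: (e \in E2) => //=.
by rewrite !Y2 ?(tt_tail tt2) ?(tt_head tt2) // andbN.
Qed.

Section SeriesGraph.
Variables (G : digraph) (V1 V2 : {set node G}) (E1 E2 : {set edge G}).
Variables u w v : node G.
Hypothesis tt1 : two_terminal V1 E1 u w.
Hypothesis tt2 : two_terminal V2 E2 w v.
Hypothesis VI : V1 :&: V2 = [set w].

(** Contracts everything outside [V] to [w]. Clamping both ends of a commodity gives its portion
    inside [V], which may be trivial. *)
Definition clamp (V : {set node G}) x := if x \in V then x else w.

Lemma series_start2 : u \notin V2.
Proof.
have/setP/(_ u) := VI; rewrite !inE (tt_start tt1) /= => ->; exact: tt_neq tt1.
Qed.

Lemma series_end1 : v \notin V1.
Proof.
have/setP/(_ v) := VI; rewrite !inE (tt_end tt2) andbT => ->.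
by rewrite eq_sym; exact: tt_neq tt2.
Qed.

Lemma clamp_in (V : {set node G}) x : x \in V -> clamp V x = x.
Proof. by rewrite /clamp => ->. Qed.

Lemma clamp1 x : x \in V2 -> clamp V1 x = w.
Proof.
by rewrite /clamp => x2; case: ifP => // x1; apply/set1P; rewrite -VI inE x1.
Qed.

Lemma clamp2 x : x \in V1 -> clamp V2 x = w.
Proof.
by rewrite /clamp => x1; case: ifP => // x2; apply/set1P; rewrite -VI inE x1.
Qed.

Lemma clamp_mem1 x : clamp V1 x \in V1.
Proof. by rewrite /clamp; case: ifP => // _; exact: tt_end tt1. Qed.

Lemma clamp_mem2 x : clamp V2 x \in V2.
Proof. by rewrite /clamp; case: ifP => // _; exact: tt_start tt2. Qed.

Lemma series_two_terminal : two_terminal (V1 :|: V2) (E1 :|: E2) u v.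
Proof.
have u2 := series_start2; have v1 := series_end1; split.
- by apply: contraNneq u2 => ->; exact: tt_end tt2.
- by rewrite inE (tt_start tt1).
- by rewrite inE (tt_end tt2) orbT.
- by move=> e; rewrite !inE => /orP[/(tt_tail tt1)->|/(tt_tail tt2)->]; rewrite ?orbT.
- by move=> e; rewrite !inE => /orP[/(tt_head tt1)->|/(tt_head tt2)->]; rewrite ?orbT.
- move=> e; rewrite !inE => /orP[/(tt_source tt1)//|/(tt_head tt2)].
  by move=> e2; apply: contraNneq u2 => <-.
- move=> e; rewrite !inE => /orP[/(tt_tail tt1)|/(tt_sink tt2)//].
  by move=> e2; apply: contraNneq v1 => <-.
- apply: (has_path_trans (y := w)).
    by apply: has_pathS (tt_path tt1); exact: subsetUl.
  by apply: has_pathS (tt_path tt2); exact: subsetUr.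
Qed.

(** Clamping contracts all arcs of the other side to [w], so it projects paths. Conversely the two
    projections are joined at [w]; if [s] is in [V2] and [t] in [V1], both are forced to be [w],
    since [w] ends side 1 and starts side 2. *)
Lemma series_has_path (A1 A2 : {set edge G}) s t :
  A1 \subset E1 -> A2 \subset E2 -> s \in V1 :|: V2 -> t \in V1 :|: V2 ->
  has_path (A1 :|: A2) s t =
  has_path A1 (clamp V1 s) (clamp V1 t) && has_path A2 (clamp V2 s) (clamp V2 t).
Proof.
move=> /[dup] AE1 /subsetP AE1' /[dup] AE2 /subsetP AE2' sV tV.
apply/idP/andP => [st|[]].
  split; apply: has_path_map st => e; rewrite inE => /orP[eA|eA].
  - by rewrite !clamp_in ?(has_path_arc eA) ?(tt_tail tt1) ?(tt_head tt1) ?AE1'.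
  - by rewrite !clamp1 ?has_path_refl ?(tt_tail tt2) ?(tt_head tt2) ?AE2'.
  - by rewrite !clamp2 ?has_path_refl ?(tt_tail tt1) ?(tt_head tt1) ?AE1'.
  - by rewrite !clamp_in ?(has_path_arc eA) ?(tt_tail tt2) ?(tt_head tt2) ?AE2'.
have S1 : A1 \subset A1 :|: A2 := subsetUl _ _.
have S2 : A2 \subset A1 :|: A2 := subsetUr _ _.
move: sV tV; rewrite !inE => /orP[s1|s2] /orP[t1|t2].
- by rewrite (clamp_in s1) (clamp_in t1) => /(has_pathS S1).
- rewrite (clamp_in s1) (clamp1 t2) (clamp2 s1) (clamp_in t2).
  by move=> /(has_pathS S1) sw /(has_pathS S2); exact: has_path_trans.
- rewrite (clamp1 s2) (clamp_in t1) (clamp_in s2) (clamp2 t1).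
  move=> /(has_path_from_end tt1 AE1) -> /(has_path_to_start tt2 AE2) ->.
  exact: has_path_refl.
- by rewrite (clamp_in s2) (clamp_in t2) => _ /(has_pathS S2).
Qed.

End SeriesGraph.

Lemma setDIU (G : digraph) (E1 E2 F : {set edge G}) :
  (E1 :|: E2) :\: ((E1 :|: E2) :&: F) = E1 :\: (E1 :&: F) :|: E2 :\: (E2 :&: F).
Proof. by apply/setP=> e; rewrite !inE; do ![case: (_ \in _)]. Qed.

(* Whether w is in X decides on which side the cut is left as it is by series_cut;
   on the other side it is made inner by adding v or by removing u. *)
Lemma series_split_cut (G : digraph) (V1 V2 : {set node G}) (E1 E2 : {set edge G})
    u w v (X : {set node G}) :
  two_terminal V1 E1 u w -> two_terminal V2 E2 w v -> V1 :&: V2 = [set w] ->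
  u \in X -> v \notin X ->
  exists Y1 Y2 : {set node G},
    [/\ u \in Y1 -> v \in Y1, u \in Y2 -> v \in Y2,
        (E1 :|: E2) :&: out_cut Y1 = E1 :&: out_cut X
      & (E1 :|: E2) :&: out_cut Y2 = E2 :&: out_cut X].
Proof.
move=> tt1 tt2 VI uX vX.
have u2 := series_start2 tt1 VI; have v1 := series_end1 tt2 VI.
have Y1eq := series_cut X tt1 tt2 VI; have := series_cut X tt2 tt1.
rewrite setIC setUC => /(_ _ VI) Y2eq.
have mid x : x \in V1 -> x \in V2 -> x = w.
  by move=> x1 x2; apply/set1P; rewrite -VI inE x1.
case: ifP Y1eq Y2eq => wX Y1eq Y2eq.
  exists (X :&: V1 :|: V2), ((V1 :|: X) :\ u); split=> //.
  - by rewrite !inE (tt_end tt2) orbT.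
  - by rewrite !inE eqxx.
  apply/setP=> e; rewrite !inE.
  case e1: (e \in E1) => /=.
    rewrite (tt_source tt1 e1) (tt_head tt1 e1) /= andbF; apply/esym/negP.
    case/and3P=> e2 _; rewrite (mid _ (tt_head tt1 e1) (tt_head tt2 e2)).
    by rewrite wX.
  case e2: (e \in E2) => //=.
  have X2 x : x \in V2 -> (x != u) && ((x \in V1) || (x \in X)) = (x \in X).
    move=> x2; rewrite (contraNneq _ u2) => [|<- //] /=.
    by case x1: (x \in V1); rewrite // (mid x).
  by rewrite !X2 ?(tt_tail tt2) ?(tt_head tt2).
exists (v |: X :&: V1), (X :&: V2); split=> //.
- by rewrite !inE eqxx.
- by rewrite !inE (negPf u2) andbF.
apply/setP=> e; rewrite !inE.
case e1: (e \in E1) => /=.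
  have X1 x : x \in V1 -> (x == v) || (x \in X) && (x \in V1) = (x \in X).
    by move=> x1; rewrite x1 andbT; case: eqP x1 v1 => // -> ->.
  by rewrite !X1 ?(tt_tail tt1) ?(tt_head tt1).
case e2: (e \in E2) => //=; rewrite (negPf (tt_sink tt2 e2)) /=.
apply/negP=> /andP[/andP[tX t1] _].
by move: tX; rewrite (mid _ t1 (tt_tail tt2 e2)) wX.
Qed.

(** * Paths and cuts in a parallel composition *)

Section ParallelGraph.
Variables (G : digraph) (V1 V2 : {set node G}) (E1 E2 : {set edge G}).
Variables u v : node G.
Hypothesis tt1 : two_terminal V1 E1 u v.
Hypothesis tt2 : two_terminal V2 E2 u v.
Hypothesis VI : V1 :&: V2 = [set u; v].

Lemma parallel_two_terminal : two_terminal (V1 :|: V2) (E1 :|: E2) u v.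
Proof.
split.
- exact: tt_neq tt1.
- by rewrite inE (tt_start tt1).
- by rewrite inE (tt_end tt1).
- by move=> e; rewrite !inE => /orP[/(tt_tail tt1)->|/(tt_tail tt2)->]; rewrite ?orbT.
- by move=> e; rewrite !inE => /orP[/(tt_head tt1)->|/(tt_head tt2)->]; rewrite ?orbT.
- by move=> e; rewrite !inE => /orP[/(tt_source tt1)|/(tt_source tt2)].
- by move=> e; rewrite !inE => /orP[/(tt_sink tt1)|/(tt_sink tt2)].
- by apply: has_pathS (tt_path tt1); exact: subsetUl.
Qed.

Lemma parallel_terminal x : x \in V1 -> x \in V2 -> x = u \/ x = v.
Proof. by move=> x1 x2; apply/set2P; rewrite -VI inE x1. Qed.

(** A path could change sides only at [u] or [v], but no arc leaves [v], and at [u] the path has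
    only just begun. *)
Lemma parallel_has_path (A1 A2 : {set edge G}) s t :
  A1 \subset E1 -> A2 \subset E2 -> s \in V1 :|: V2 -> has_path (A1 :|: A2) s t ->
  [&& s \in V1, t \in V1 & has_path A1 s t] || [&& s \in V2, t \in V2 & has_path A2 s t].
Proof.
move=> AE1 AE2 sV st.
have AE1' := subsetP AE1; have AE2' := subsetP AE2.
apply: (has_path_closed _ st (P := fun y => [&& s \in V1, y \in V1 & has_path A1 s y] ||
   [&& s \in V2, y \in V2 & has_path A2 s y])); last first.
  by move: sV; rewrite inE !has_path_refl !andbT !andbb.
move=> e; rewrite inE => /orP[] eA /orP[] /and3P[sV' tV sp].
- apply/orP; left; rewrite sV' (tt_head tt1 (AE1' _ eA)).
  exact: has_path_trans sp (has_path_arc eA).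
(* The arc lies in [E1] while the path so far lies in side 2. Its tail must be [u], hence the path
   so far is trivial and can be counted to side 1. *)
- have [tu|tv] := parallel_terminal (tt_tail tt1 (AE1' _ eA)) tV; last first.
    by have := tt_sink tt1 (AE1' _ eA); rewrite tv eqxx.
  rewrite tu in sp; apply/orP; left.
  rewrite (has_path_to_start tt2 AE2 sp) (tt_start tt1) (tt_head tt1 (AE1' _ eA)).
  by rewrite -tu; exact: has_path_arc.
- have [tu|tv] := parallel_terminal tV (tt_tail tt2 (AE2' _ eA)); last first.
    by have := tt_sink tt2 (AE2' _ eA); rewrite tv eqxx.
  rewrite tu in sp; apply/orP; right.
  rewrite (has_path_to_start tt1 AE1 sp) (tt_start tt2) (tt_head tt2 (AE2' _ eA)).
  by rewrite -tu; exact: has_path_arc.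
- apply/orP; right; rewrite sV' (tt_head tt2 (AE2' _ eA)).
  exact: has_path_trans sp (has_path_arc eA).
Qed.

(** If the path runs on side 2, then [s] and [t] are both terminals, and as the pair is not (u,v)
    the path is trivial. *)
Lemma parallel_has_path1 (A1 A2 : {set edge G}) s t :
  A1 \subset E1 -> A2 \subset E2 -> s \in V1 -> t \in V1 ->
  ~~ ((s == u) && (t == v)) -> has_path (A1 :|: A2) s t -> has_path A1 s t.
Proof.
move=> AE1 AE2 s1 t1 nuv /(parallel_has_path AE1 AE2); rewrite inE s1 t1 => /(_ isT).
case/orP=> //= /and3P[s2 t2 st]; move: nuv.
have [su|sv] := parallel_terminal s1 s2; have [tu|tv] := parallel_terminal t1 t2.
- by rewrite su tu has_path_refl.
- by rewrite su tv !eqxx.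
- by move: st; rewrite tu => /(has_path_to_start tt2 AE2)->; rewrite has_path_refl.
- by rewrite sv tv has_path_refl.
Qed.

(** If [u], and hence [v], lies in [X], adding all of [V2] keeps the arcs of [E2] uncut. Otherwise
    [V2] meets the restriction to [V1] at most in [v], which no arc leaves. *)
Lemma parallel_cut (X : {set node G}) : (u \in X -> v \in X) ->
  exists2 Y : {set node G}, u \in Y -> v \in Y &
    (E1 :|: E2) :&: out_cut Y = E1 :&: out_cut X.
Proof.
move=> uvX; case uX: (u \in X).
  exists (X :&: V1 :|: V2); first by rewrite !inE (tt_end tt2) orbT.
  have Y1 x : x \in V1 -> (x \in X :&: V1 :|: V2) = (x \in X).
    move=> x1; rewrite !inE x1 andbT; case x2: (x \in V2); rewrite ?orbF // orbT.
    by case: (parallel_terminal x1 x2) => ->; rewrite ?uX ?uvX.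
  apply/setP=> e; rewrite !(in_setI, in_setU, in_set (fun _ => _ && _)).
  case e1: (e \in E1) => /=.
    by rewrite -!in_setI -!in_setU !Y1 ?(tt_tail tt1) ?(tt_head tt1).
  by case e2: (e \in E2) => //=; rewrite (tt_head tt2 e2) orbT andbF.
exists (X :&: V1); first by rewrite inE uX.
apply/setP=> e; rewrite !inE.
case e1: (e \in E1) => /=; first by rewrite (tt_tail tt1 e1) (tt_head tt1 e1) !andbT.
case e2: (e \in E2) => //=; apply/negP => /andP[/andP[tX t1] _].
have [tu|tv] := parallel_terminal t1 (tt_tail tt2 e2).
  by rewrite tu uX in tX.
by have := tt_sink tt2 e2; rewrite tv eqxx.
Qed.

(** Crossing cuts of the two sides agree on the shared nodes [u] and [v], so any two of them can be
    glued. *)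
Lemma parallel_cutU (X Y : {set node G}) :
  u \in X -> v \notin X -> u \in Y -> v \notin Y ->
  (E1 :|: E2) :&: out_cut (X :&: V1 :|: Y :&: V2)
  = E1 :&: out_cut X :|: E2 :&: out_cut Y.
Proof.
move=> uX /negPf vX uY /negPf vY.
have Z1 x : x \in V1 -> (x \in X) && (x \in V1) || (x \in Y) && (x \in V2) = (x \in X).
  move=> x1; rewrite x1 andbT; case x2: (x \in V2); rewrite ?andbF ?orbF // andbT.
  by case: (parallel_terminal x1 x2) => ->; rewrite ?uX ?uY ?vX ?vY.
have Z2 x : x \in V2 -> (x \in X) && (x \in V1) || (x \in Y) && (x \in V2) = (x \in Y).
  move=> x2; rewrite x2 andbT; case x1: (x \in V1); rewrite ?andbF ?orbF // andbT.
  by case: (parallel_terminal x1 x2) => ->; rewrite ?uX ?uY ?vX ?vY.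
apply/setP=> e; rewrite !inE.
case e1: (e \in E1) => /=.
  rewrite !Z1 ?(tt_tail tt1) ?(tt_head tt1) //.
  case e2: (e \in E2); rewrite ?orbF //=.
  have YX x : x \in V1 -> x \in V2 -> (x \in Y) = (x \in X).
    by move=> x1 x2; rewrite -(Z2 x x2) Z1.
  rewrite (YX _ (tt_tail tt1 e1) (tt_tail tt2 e2)).
  by rewrite (YX _ (tt_head tt1 e1) (tt_head tt2 e2)) orbb.
by case e2: (e \in E2) => //=; rewrite !Z2 ?(tt_tail tt2) ?(tt_head tt2).
Qed.

End ParallelGraph.

(** * Comparison of sums, and the choice of a splitting ratio *)

Lemma sum_disjointU (R : nmodType) (T : finType) (A B : {set T}) (f : T -> R) :
  [disjoint A & B] ->
  \sum_(x in A :|: B) f x = \sum_(x in A) f x + \sum_(x in B) f x.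
Proof. by move=> AB; rewrite -bigU //=; apply: eq_bigl => x; rewrite !inE. Qed.

Lemma ler_sum_subpred (R : numDomainType) (I : finType) (P Q : pred I) (f g : I -> R) :
  (forall i, Q i -> 0 <= g i) -> (forall i, P i -> Q i && (f i <= g i)) ->
  \sum_(i | P i) f i <= \sum_(i | Q i) g i.
Proof.
move=> g0 PQ; rewrite big_mkcond [leRHS]big_mkcond; apply: ler_sum => i _.
case: ifP => [/PQ /andP[-> //]|_]; case: ifP => // Qi; exact: g0.
Qed.

Lemma ler_sum_predU (R : numDomainType) (I : finType) (P Q1 Q2 : pred I) (f : I -> R) :
  (forall i, 0 <= f i) -> (forall i, P i -> Q1 i || Q2 i) ->
  \sum_(i | P i) f i <= \sum_(i | Q1 i) f i + \sum_(i | Q2 i) f i.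
Proof.
move=> f0 PQ; rewrite !(big_mkcond _ f) -big_split; apply: ler_sum => i _ /=.
have := PQ i; case: (P i) => [/(_ isT)|_]; last first.
  by do 2![case: ifP => _]; rewrite ?addr0 ?add0r ?addr_ge0.
by case: (Q1 i) => /=; [case: (Q2 i); rewrite ?addr0 ?lerDl | move=> ->; rewrite add0r].
Qed.

Lemma split_ratio (R : realFieldType) (T : finType) (P : pred T) (x0 : T)
    (m1 m2 : T -> R) (D : R) :
  P x0 -> 0 <= D -> (forall x, P x -> 0 <= m1 x) -> (forall x, P x -> 0 <= m2 x) ->
  (forall x y, P x -> P y -> D <= m1 x + m2 y) ->
  exists l : R, [/\ 0 <= l, l <= 1, forall x, P x -> l * D <= m1 x
    & forall x, P x -> (1 - l) * D <= m2 x].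
Proof.
move=> Px0 D0 m1_ge0 m2_ge0 Dm.
case: (eqVneq D 0) => [->|Dn0].
  by exists 0; split=> // x Px; rewrite mulr0 ?m1_ge0 ?m2_ge0.
have [x1 Px1 x1min] := @arg_minP _ R T x0 P m1 Px0.
(* Side 1 takes as much of [D] as its tightest bound permits. Either this is all of [D], or the
   remainder is [D - m1 x1], which [Dm] bounds by every [m2 x]. *)
exists (Num.min D (m1 x1) / D); rewrite mulrBl divfK // mul1r.
have Dgt0 : 0 < D by rewrite lt_def Dn0.
split=> [|||x Px].
- by rewrite divr_ge0 // le_min D0 m1_ge0.
- by rewrite ler_pdivrMr // mul1r ge_min lexx.
- by move=> x Px; rewrite ge_min x1min ?orbT.
- have := Dm x1 x Px1 Px; rewrite lerBlDr.
  case: (lerP D (m1 x1)) => _; first by rewrite lerDr m2_ge0.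
  by rewrite addrC.
Qed.

(** * Cut conditions and routings inside a component *)

Section Routing.
Variables (R : realType) (G : digraph) (c : edge G -> R) (I : finType).
Implicit Types (V X Y : {set node G}) (E F : {set edge G}) (s t : I -> node G).
Implicit Types (d : I -> R) (a : pred I) (i : I) (y u v w : node G).

Definition spans u v s t i := (s i == u) && (t i == v).

Definition cuts E F s t i := ~~ has_path (E :\: F) (s i) (t i).

(** Zero demands and equal ends are allowed, because clamping, restricting and scaling produce such
    commodities. *)
Record commodities V E s t d : Prop := Commodities {
  com_ge0 : forall i, 0 <= d i;
  com_source : forall i, s i \in V;
  com_sink : forall i, t i \in V;
  com_path : forall i, has_path E (s i) (t i)
}.

(** With the (u,v)-commodities left out, the condition does not depend on the share of their demand
    that a parallel composition assigns to the component. *)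
Definition inner_condition E u v s t d := forall X, (u \in X -> v \in X) ->
  \sum_(i | ~~ spans u v s t i && cuts E (E :&: out_cut X) s t i) d i
    <= \sum_(e in E :&: out_cut X) c e.

Definition cross_condition E u v s t d := forall X, u \in X -> v \notin X ->
  \sum_(i | cuts E (E :&: out_cut X) s t i) d i <= \sum_(e in E :&: out_cut X) c e.

(** Writing the divergence as a difference of indicators makes it vanish for a commodity with equal
    ends. *)
Definition routing E s t d (x : edge G -> I -> R) : Prop :=
  [/\ forall e i, e \in E -> 0 <= x e i,
      forall y i,
        \sum_(e in E | arc_tail e == y) x e i - \sum_(e in E | arc_head e == y) x e i
        = d i * ((y == s i)%:R - (y == t i)%:R)
    & forall e, e \in E -> \sum_i x e i <= c e].

(** Quantified over all commodities, since the induction changes their ends and demands. [cs_slack]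
    is carried along because [split_ratio] needs nonnegative residual capacities. *)
Record cut_sufficient V E u v : Prop := CutSufficient {
  cs_slack : forall s t d, commodities V E s t d -> inner_condition E u v s t d ->
    forall X, u \in X -> v \notin X ->
    \sum_(i | ~~ spans u v s t i && cuts E (E :&: out_cut X) s t i) d i
      <= \sum_(e in E :&: out_cut X) c e;
  cs_routing : forall s t d, commodities V E s t d -> inner_condition E u v s t d ->
    cross_condition E u v s t d -> exists x, routing E s t d x
}.

Lemma routingU E1 E2 s1 t1 d1 s2 t2 d2 s t d x1 x2 :
  [disjoint E1 & E2] -> routing E1 s1 t1 d1 x1 -> routing E2 s2 t2 d2 x2 ->
  (forall y i, d i * ((y == s i)%:R - (y == t i)%:R) =
     d1 i * ((y == s1 i)%:R - (y == t1 i)%:R) + d2 i * ((y == s2 i)%:R - (y == t2 i)%:R)) ->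
  routing (E1 :|: E2) s t d (fun e i => if e \in E1 then x1 e i else x2 e i).
Proof.
move=> dis [x1_ge0 x1_div x1_cap] [x2_ge0 x2_div x2_cap] div.
have sumU (P : pred (edge G)) i :
    \sum_(e in E1 :|: E2 | P e) (if e \in E1 then x1 e i else x2 e i)
    = \sum_(e in E1 | P e) x1 e i + \sum_(e in E2 | P e) x2 e i.
  rewrite !big_mkcondr sum_disjointU //=; congr (_ + _).
    by apply: eq_bigr => e ->.
  apply: eq_bigr => e eE.
  by rewrite (disjointFl dis eE).
split=> [e i|y i|e].
- by rewrite inE; case: ifP => [e1 _|_ /= e2]; [exact: x1_ge0 | exact: x2_ge0].
- by rewrite !sumU div -x1_div -x2_div opprD addrACA.
- by rewrite inE; case e1: (e \in E1) => /= e2; [exact: x1_cap | exact: x2_cap].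
Qed.

(** Every commodity is trivial or runs from tail to head, so sending the latter over [e] is the only
    choice; the crossing cut at the tail is exactly [e]. *)
Lemma cut_sufficient_arc e : 0 <= c e -> arc_tail e != arc_head e ->
  cut_sufficient [set arc_tail e; arc_head e] [set e] (arc_tail e) (arc_head e).
Proof.
move=> ce te; set u := arc_tail e; set v := arc_head e.
have triv s t d i : commodities [set u; v] [set e] s t d -> ~~ spans u v s t i -> s i = t i.
  move=> com; case: (has_path_set1 (com_path com i)) => [-> //|[su tv]].
  by rewrite /spans su tv !eqxx.
split=> s t d com inner.
  move=> X uX vX; rewrite big_pred0 => [|i]; last first.
    apply/negP=> /andP[/(triv _ _ _ _ com) st].
    by rewrite /cuts st has_path_refl.
  by apply: sumr_ge0 => f; rewrite !inE => /andP[/eqP->].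
move=> /(_ [set u]); rewrite !inE eqxx eq_sym te => /(_ isT isT) cross.
exists (fun _ i => if spans u v s t i then d i else 0); split=> [f i _|y i|f].
- by case: ifP => // _; exact: com_ge0 com i.
- have set1 (P : pred (edge G)) z : \sum_(f in [set e] | P f) z = if P e then z else 0 :> R.
    by rewrite big_mkcondr big_set1.
  rewrite !set1; case sp: (spans u v s t i); last first.
    by rewrite !if_same (triv _ _ _ _ com (negbT sp)) !subrr mulr0.
  case/andP: sp => /eqP-> /eqP->.
  by rewrite ![y == _]eq_sym -/u -/v; do 2!case: (_ == y); rewrite /=; ring.
- move=> /set1P->; rewrite -big_mkcond /=.
  have cutE : [set e] :&: out_cut [set u] = [set e].
    by apply/setIidPl; rewrite sub1set !inE eqxx eq_sym.
  have -> : c e = \sum_(e0 in [set e] :&: out_cut [set u]) c e0 by rewrite cutE big_set1.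
  apply: le_trans cross.
  apply: ler_sum_subpred => [i _|i /andP[/eqP su /eqP tv]]; first exact: com_ge0 com i.
  rewrite lexx andbT /cuts su tv; apply: out_cut_separates; first exact: set11.
  by rewrite inE eq_sym.
Qed.

Lemma sum_spans_cuts_le E F E' F' u v u' v' s t s' t' d :
  (forall i, 0 <= d i) ->
  (forall i, spans u v s t i -> spans u' v' s' t' i) ->
  (forall i, has_path (E :\: F) (s i) (t i) -> has_path (E' :\: F') (s' i) (t' i)) ->
  \sum_(i | ~~ spans u' v' s' t' i && cuts E' F' s' t' i) d i
    <= \sum_(i | ~~ spans u v s t i && cuts E F s t i) d i.
Proof.
move=> d0 sp st; apply: ler_sum_subpred => // i /andP[nsp].
rewrite /cuts lexx andbT => nst; apply/andP; split; last by apply: contra nst => /st.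
by apply: contra nsp => /sp.
Qed.

(** * Routing in a series composition *)

Section Series.
Variables (V1 V2 : {set node G}) (E1 E2 : {set edge G}) (u w v : node G).
Hypothesis tt1 : two_terminal V1 E1 u w.
Hypothesis tt2 : two_terminal V2 E2 w v.
Hypothesis dE : [disjoint E1 & E2].
Hypothesis VI : V1 :&: V2 = [set w].
Variables (s t : I -> node G) (d : I -> R).
Hypothesis com : commodities (V1 :|: V2) (E1 :|: E2) s t d.

Let s1 i := clamp w V1 (s i).
Let t1 i := clamp w V1 (t i).
Let s2 i := clamp w V2 (s i).
Let t2 i := clamp w V2 (t i).

Lemma series_has_pathD F i : has_path ((E1 :|: E2) :\: F) (s i) (t i) =
  has_path (E1 :\: F) (s1 i) (t1 i) && has_path (E2 :\: F) (s2 i) (t2 i).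
Proof.
by rewrite setDUl (series_has_path tt1 tt2 VI) ?subsetDl ?(com_source com) ?(com_sink com).
Qed.

Lemma series_commodities1 : commodities V1 E1 s1 t1 d.
Proof.
split=> [|i|i|i]; [exact: com_ge0 com|exact: clamp_mem1 tt1 _|exact: clamp_mem1 tt1 _|].
by have := com_path com i; rewrite -(setD0 (_ :|: _)) series_has_pathD !setD0 => /andP[].
Qed.

Lemma series_commodities2 : commodities V2 E2 s2 t2 d.
Proof.
split=> [|i|i|i]; [exact: com_ge0 com|exact: clamp_mem2 tt2 _|exact: clamp_mem2 tt2 _|].
by have := com_path com i; rewrite -(setD0 (_ :|: _)) series_has_pathD !setD0 => /andP[].
Qed.

Lemma series_spans i : spans u v s t i -> spans u w s1 t1 i && spans w v s2 t2 i.
Proof.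
case/andP=> /eqP su /eqP tv; rewrite /spans /s1 /s2 /t1 /t2 su tv.
rewrite (clamp_in w (tt_start tt1)) (clamp_in w (tt_end tt2)).
by rewrite (clamp1 VI (tt_end tt2)) (clamp2 VI (tt_start tt1)) !eqxx.
Qed.

Lemma series_inner1 : inner_condition (E1 :|: E2) u v s t d -> inner_condition E1 u w s1 t1 d.
Proof.
move=> inner X uwX; have cutE := series_cut X tt1 tt2 VI.
set Y := (if _ then _ else _) in cutE.
have /inner : u \in Y -> v \in Y.
  (* With [w] in [X] the extended cut contains [v]; without [w], the inner cut [X] also misses
     [u]. *)
  rewrite /Y; case: ifP => wX; first by rewrite !inE (tt_end tt2) orbT.
  by rewrite inE => /andP[/uwX]; rewrite wX.
rewrite cutE; apply: le_trans; apply: sum_spans_cuts_le => i; first exact: com_ge0 com i.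
  by case/series_spans/andP.
by rewrite series_has_pathD => /andP[].
Qed.

Lemma series_inner2 : inner_condition (E1 :|: E2) u v s t d -> inner_condition E2 w v s2 t2 d.
Proof.
move=> inner X wvX; have := series_cut X tt2 tt1; rewrite setIC setUC => /(_ _ VI) cutE.
set Y := (if _ then _ else _) in cutE.
have /inner : u \in Y -> v \in Y.
  rewrite /Y; case: ifP => wX; first by rewrite !inE (tt_end tt2) wvX.
  by rewrite inE (negPf (series_start2 tt1 VI)) andbF.
rewrite cutE; apply: le_trans; apply: sum_spans_cuts_le => i; first exact: com_ge0 com i.
  by case/series_spans/andP.
by rewrite series_has_pathD => /andP[].
Qed.

Lemma series_cross1 : cross_condition (E1 :|: E2) u v s t d -> cross_condition E1 u w s1 t1 d.
Proof.
move=> cross X uX /negPf wX; have := series_cut X tt1 tt2 VI; rewrite wX => cutE.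
have := cross (X :&: V1); rewrite !inE uX (tt_start tt1) => /(_ isT).
rewrite (negPf (series_end1 tt2 VI)) andbF => /(_ isT).
rewrite cutE; apply: le_trans; apply: ler_sum_subpred => [i _|i]; first exact: com_ge0 com i.
by rewrite lexx andbT; apply: contra; rewrite series_has_pathD => /andP[].
Qed.

Lemma series_cross2 : cross_condition (E1 :|: E2) u v s t d -> cross_condition E2 w v s2 t2 d.
Proof.
move=> cross X wX /negPf vX; have := series_cut X tt2 tt1; rewrite setIC setUC => /(_ _ VI).
rewrite wX => cutE.
have := cross (X :&: V2 :|: V1); rewrite !inE (tt_start tt1) orbT => /(_ isT).
rewrite vX (negPf (series_end1 tt2 VI)) => /(_ isT).
rewrite cutE; apply: le_trans; apply: ler_sum_subpred => [i _|i]; first exact: com_ge0 com i.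
by rewrite lexx andbT; apply: contra; rewrite series_has_pathD => /andP[].
Qed.

(** A commodity that survives both inner cuts keeps a portion on side 1 from the first and one on
    side 2 from the second, hence survives the crossing cut. *)
Lemma series_slack : inner_condition (E1 :|: E2) u v s t d ->
  forall X, u \in X -> v \notin X ->
  \sum_(i | ~~ spans u v s t i && cuts (E1 :|: E2) ((E1 :|: E2) :&: out_cut X) s t i) d i
    <= \sum_(e in (E1 :|: E2) :&: out_cut X) c e.
Proof.
move=> inner X uX vX.
have [Y1 [Y2 [/inner le1 /inner le2 cut1 cut2]]] := series_split_cut tt1 tt2 VI uX vX.
rewrite [leRHS](_ : _ = \sum_(e in E1 :&: out_cut X) c e
                        + \sum_(e in E2 :&: out_cut X) c e); last first.
  by rewrite setIUl sum_disjointU // (disjointW _ _ dE) ?subsetIl.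
rewrite cut1 in le1; rewrite cut2 in le2.
apply: le_trans (lerD le1 le2); apply: ler_sum_predU; first exact: com_ge0 com.
move=> i /andP[-> /=]; rewrite /cuts -negb_and; apply: contra.
rewrite setDIU !series_has_pathD => /andP[/andP[p1 _] /andP[_ p2]].
have := series_has_path tt1 tt2 VI (subsetDl E1 (E1 :&: out_cut X))
  (subsetDl E2 (E2 :&: out_cut X)) (com_source com i) (com_sink com i).
by move=> ->; rewrite p1 p2.
Qed.

(** The two clamps of a node [x] are [x] and [w] in some order, so the contributions at [w] cancel
    between source and sink. *)
Lemma series_div y i : d i * ((y == s i)%:R - (y == t i)%:R) =
  d i * ((y == s1 i)%:R - (y == t1 i)%:R) + d i * ((y == s2 i)%:R - (y == t2 i)%:R).
Proof.
have clampD x : x \in V1 :|: V2 ->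
    (y == clamp w V1 x)%:R + (y == clamp w V2 x)%:R = (y == x)%:R + (y == w)%:R :> R.
  rewrite inE => /orP[x1|x2]; first by rewrite (clamp_in w x1) (clamp2 VI x1).
  by rewrite (clamp_in w x2) (clamp1 VI x2) addrC.
rewrite -mulrDr; congr (_ * _); have := clampD _ (com_source com i).
have := clampD _ (com_sink com i); rewrite -/(s1 i) -/(s2 i) -/(t1 i) -/(t2 i); lra.
Qed.

End Series.

Lemma cut_sufficient_series V1 V2 E1 E2 u w v :
  two_terminal V1 E1 u w -> two_terminal V2 E2 w v -> [disjoint E1 & E2] ->
  V1 :&: V2 = [set w] -> cut_sufficient V1 E1 u w -> cut_sufficient V2 E2 w v ->
  cut_sufficient (V1 :|: V2) (E1 :|: E2) u v.
Proof.
move=> tt1 tt2 dE VI cs1 cs2; split=> s t d com inner.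
  exact (series_slack tt1 tt2 dE VI com inner).
move=> cross.
have [x1 r1] := cs_routing cs1 (series_commodities1 tt1 tt2 VI com)
  (series_inner1 tt1 tt2 VI com inner) (series_cross1 tt1 tt2 VI com cross).
have [x2 r2] := cs_routing cs2 (series_commodities2 tt1 tt2 VI com)
  (series_inner2 tt1 tt2 VI com inner) (series_cross2 tt1 tt2 VI com cross).
by eexists; apply: routingU dE r1 r2 (series_div VI com).
Qed.

(** * Routing in a parallel composition *)

(** Commodities outside [a] become trivial ones at [u], so that both sides keep the index type
    [I]. *)
Definition restrict u a (s : I -> node G) i := if a i then s i else u.

Lemma spans_restrict u v a s t i : u != v ->
  spans u v (restrict u a s) (restrict u a t) i = a i && spans u v s t i.
Proof. by move=> /negPf uv; rewrite /spans /restrict; case: (a i); rewrite // eqxx uv. Qed.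

Lemma cuts_restrict u a E F s t i :
  cuts E F (restrict u a s) (restrict u a t) i = a i && cuts E F s t i.
Proof. by rewrite /cuts /restrict; case: (a i); rewrite // has_path_refl. Qed.

Section ParallelSide.
Variables (V1 V2 : {set node G}) (E1 E2 : {set edge G}) (u v : node G).
Hypothesis tt1 : two_terminal V1 E1 u v.
Hypothesis tt2 : two_terminal V2 E2 u v.
Hypothesis VI : V1 :&: V2 = [set u; v].
Variables (s t : I -> node G) (d : I -> R).
Hypothesis com : commodities (V1 :|: V2) (E1 :|: E2) s t d.
Variable a : pred I.
Hypothesis aP : forall i, a i -> [&& s i \in V1, t i \in V1 & has_path E1 (s i) (t i)].

Lemma parallel_commodities d' : (forall i, 0 <= d' i) ->
  commodities V1 E1 (restrict u a s) (restrict u a t) d'.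
Proof.
by move=> d'0; split=> // i; rewrite /restrict; case: ifP => [/aP/and3P[]//|_];
  rewrite ?(tt_start tt1) ?has_path_refl.
Qed.

Lemma parallel_cuts F i : a i -> ~~ spans u v s t i ->
  cuts E1 F s t i -> cuts (E1 :|: E2) F s t i.
Proof.
move=> /aP/and3P[s1 t1 _] nuv; apply: contra; rewrite setDUl.
exact: (parallel_has_path1 tt1 tt2 VI (subsetDl _ _) (subsetDl _ _)).
Qed.

Lemma parallel_inner d' : (forall i, ~~ spans u v s t i -> d' i = d i) ->
  inner_condition (E1 :|: E2) u v s t d ->
  inner_condition E1 u v (restrict u a s) (restrict u a t) d'.
Proof.
move=> d'E inner X /(parallel_cut tt1 tt2 VI)[Y /inner + cutE]; rewrite cutE.
apply: le_trans; apply: ler_sum_subpred => [i _|i]; first exact: com_ge0 com i.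
rewrite spans_restrict ?(tt_neq tt1) // cuts_restrict => /and3P[+ ai cut1].
by rewrite ai => /= nuv; rewrite nuv parallel_cuts // d'E //= lexx.
Qed.

End ParallelSide.

Section Parallel.
Variables (V1 V2 : {set node G}) (E1 E2 : {set edge G}) (u v : node G).
Hypothesis tt1 : two_terminal V1 E1 u v.
Hypothesis tt2 : two_terminal V2 E2 u v.
Hypothesis dE : [disjoint E1 & E2].
Hypothesis VI : V1 :&: V2 = [set u; v].
Hypothesis cs1 : cut_sufficient V1 E1 u v.
Hypothesis cs2 : cut_sufficient V2 E2 u v.
Variables (s t : I -> node G) (d : I -> R).
Hypothesis com : commodities (V1 :|: V2) (E1 :|: E2) s t d.
Hypothesis inner : inner_condition (E1 :|: E2) u v s t d.

Let uv := spans u v s t.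
Let in1 i := [&& s i \in V1, t i \in V1 & has_path E1 (s i) (t i)].
(** The (u,v)-commodities are present on both sides; any other is assigned to exactly one side, the
    first if it can be routed there. *)
Let a1 i := uv i || in1 i.
Let a2 i := uv i || ~~ in1 i.
Let s1 := restrict u a1 s.
Let t1 := restrict u a1 t.
Let s2 := restrict u a2 s.
Let t2 := restrict u a2 t.

Let VI' : V2 :&: V1 = [set u; v].
Proof. by rewrite setIC. Qed.

Let com' : commodities (V2 :|: V1) (E2 :|: E1) s t d.
Proof. by rewrite setUC [E2 :|: _]setUC. Qed.

Let inner' : inner_condition (E2 :|: E1) u v s t d.
Proof. by rewrite setUC. Qed.

Let a1P i : a1 i -> [&& s i \in V1, t i \in V1 & has_path E1 (s i) (t i)].
Proof.
by case/orP=> // /andP[/eqP-> /eqP->]; rewrite (tt_start tt1) (tt_end tt1) (tt_path tt1).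
Qed.

Let a2P i : a2 i -> [&& s i \in V2, t i \in V2 & has_path E2 (s i) (t i)].
Proof.
case/orP=> [/andP[/eqP-> /eqP->]|ni].
  by rewrite (tt_start tt2) (tt_end tt2) (tt_path tt2).
have := parallel_has_path tt1 tt2 VI (subxx _) (subxx _) (com_source com i) (com_path com i).
by rewrite -/(in1 i) (negPf ni).
Qed.

Lemma parallel_slack X : u \in X -> v \notin X ->
  \sum_(i | ~~ uv i && cuts (E1 :|: E2) ((E1 :|: E2) :&: out_cut X) s t i) d i
    <= \sum_(e in (E1 :|: E2) :&: out_cut X) c e.
Proof.
move=> uX vX.
have le1 := cs_slack cs1 (parallel_commodities tt1 a1P (com_ge0 com))
  (parallel_inner tt1 tt2 VI com a1P (fun _ _ => erefl) inner) uX vX.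
have le2 := cs_slack cs2 (parallel_commodities tt2 a2P (com_ge0 com))
  (parallel_inner tt2 tt1 VI' com' a2P (fun _ _ => erefl) inner') uX vX.
rewrite [leRHS](_ : _ = \sum_(e in E1 :&: out_cut X) c e
                        + \sum_(e in E2 :&: out_cut X) c e); last first.
  by rewrite setIUl sum_disjointU // (disjointW _ _ dE) ?subsetIl.
apply: le_trans (lerD le1 le2); apply: ler_sum_predU; first exact: com_ge0 com.
move=> i /andP[nuv cutI].
rewrite !spans_restrict ?(tt_neq tt1) // -/(uv i) (negPf nuv) !andbF /= !cuts_restrict.
rewrite /a1 /a2 (negPf nuv) /=.
case: (in1 i) => /=; move: cutI; rewrite ?orbF; apply: contra;
  apply: has_pathS; rewrite setDIU.
  exact: subsetUl.
exact: subsetUr.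
Qed.

Lemma parallel_ratio : cross_condition (E1 :|: E2) u v s t d ->
  exists l : R, [/\ 0 <= l, l <= 1,
    forall X, u \in X -> v \notin X ->
      l * (\sum_(i | uv i) d i) +
      \sum_(i | ~~ uv i && cuts E1 (E1 :&: out_cut X) s1 t1 i) d i
        <= \sum_(e in E1 :&: out_cut X) c e
  & forall X, u \in X -> v \notin X ->
      (1 - l) * (\sum_(i | uv i) d i) +
      \sum_(i | ~~ uv i && cuts E2 (E2 :&: out_cut X) s2 t2 i) d i
        <= \sum_(e in E2 :&: out_cut X) c e].
Proof.
move=> cross.
(* The residual capacity of a crossing cut after serving the commodities other than (u,v). *)
pose m E s t X := \sum_(e in E :&: out_cut X) c e
  - \sum_(i | ~~ uv i && cuts E (E :&: out_cut X) s t i) d i.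
pose P X := (u \in X) && (v \notin X).
have Pu : P [set u] by rewrite /P !inE eqxx eq_sym (tt_neq tt1).
have uv1 i : uv i = spans u v s1 t1 i.
  by rewrite spans_restrict ?(tt_neq tt1) //; apply/esym/andb_idl => ui; apply/orP; left.
have uv2 i : uv i = spans u v s2 t2 i.
  by rewrite spans_restrict ?(tt_neq tt1) //; apply/esym/andb_idl => ui; apply/orP; left.
have [||||l [l0 l1 m1 m2]] := @split_ratio R _ P [set u] (m E1 s1 t1) (m E2 s2 t2)
    (\sum_(i | uv i) d i) Pu.
- by apply: sumr_ge0 => i _; exact: com_ge0 com i.
- move=> X /andP[uX vX]; rewrite subr_ge0.
  under eq_bigl do rewrite uv1.
  exact: (cs_slack cs1 (parallel_commodities tt1 a1P (com_ge0 com))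
    (parallel_inner tt1 tt2 VI com a1P (fun _ _ => erefl) inner)).
- move=> X /andP[uX vX]; rewrite subr_ge0.
  under eq_bigl do rewrite uv2.
  exact: (cs_slack cs2 (parallel_commodities tt2 a2P (com_ge0 com))
    (parallel_inner tt2 tt1 VI' com' a2P (fun _ _ => erefl) inner')).
- move=> X Y /andP[uX vX] /andP[uY vY].
  (* The crossing condition at the glued cut bounds the whole (u,v)-demand, all of which [Z]
     separates, by the sum of the two residual capacities. *)
  set Z := X :&: V1 :|: Y :&: V2.
  have uZ : u \in Z by rewrite !inE uX (tt_start tt1).
  have vZ : v \notin Z by rewrite !inE (negPf vX) (negPf vY).
  have cutZ := parallel_cutU tt1 tt2 VI uX vX uY vY.
  have := cross Z uZ vZ; rewrite {2}cutZ sum_disjointU; last first.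
    exact: disjointW (subsetIl _ _) (subsetIl _ _) dE.
  rewrite (bigID uv) /=.
  have <- : \sum_(i | uv i) d i =
      \sum_(i | cuts (E1 :|: E2) ((E1 :|: E2) :&: out_cut Z) s t i && uv i) d i.
    apply: eq_bigl => i; apply/esym/andb_idl => /andP[/eqP su /eqP tv].
    by rewrite /cuts su tv; exact: out_cut_separates.
  (* It remains that a commodity cut on its own side is also cut by [Z]; the sum on the right is
     split by assigned side. *)
  suff : \sum_(i | ~~ uv i && cuts E1 (E1 :&: out_cut X) s1 t1 i) d i +
         \sum_(i | ~~ uv i && cuts E2 (E2 :&: out_cut Y) s2 t2 i) d i <=
         \sum_(i | cuts (E1 :|: E2) ((E1 :|: E2) :&: out_cut Z) s t i && ~~ uv i) d i.
    by rewrite /m; lra.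
  have E1Z : (E1 :|: E2) :\: ((E1 :|: E2) :&: out_cut Z)
      = E1 :\: (E1 :&: out_cut X) :|: E2 :\: (E2 :&: out_cut Y).
    rewrite cutZ; apply/setP=> e; rewrite !inE; have := disjointFr dE (x := e).
    by do 2![case: (e \in _) => //=]; rewrite ?orbF //; move/(_ isT).
  rewrite [leRHS](bigID in1) /=; apply: lerD; apply: ler_sum_subpred => i.
  + by move=> _; exact: com_ge0 com i.
  + rewrite cuts_restrict => /and3P[nuv ai cuti]; have /and3P[si ti _] := a1P ai.
    rewrite lexx nuv !andbT; move: ai; rewrite /a1 (negPf nuv) /= => ->; rewrite andbT.
    move: cuti; rewrite /cuts E1Z; apply: contra.
    exact (parallel_has_path1 tt1 tt2 VI (subsetDl _ _) (subsetDl _ _) si ti nuv).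
  + by move=> _; exact: com_ge0 com i.
  + rewrite cuts_restrict => /and3P[nuv ai cuti]; have /and3P[si ti _] := a2P ai.
    rewrite lexx nuv !andbT; move: ai; rewrite /a2 (negPf nuv) /= => ->; rewrite andbT.
    move: cuti; rewrite /cuts E1Z; apply: contra; rewrite setUC.
    exact (parallel_has_path1 tt2 tt1 VI' (subsetDl _ _) (subsetDl _ _) si ti nuv).
exists l; split=> // X uX vX.
  by have := m1 X; rewrite /P uX vX => /(_ isT); rewrite lerBrDr.
by have := m2 X; rewrite /P uX vX => /(_ isT); rewrite lerBrDr.
Qed.

(** One ratio serves all (u,v)-commodities: crossing cuts see only their total demand, and inner
    cuts ignore them. *)
Let scale (l : R) i := if uv i then l * d i else d i.

Let scale_ge0 (l : R) : 0 <= l -> forall i, 0 <= scale l i.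
Proof. by move=> l0 i; rewrite /scale; case: ifP => _; rewrite ?mulr_ge0 ?(com_ge0 com). Qed.

Lemma scaled_cross E s' t' l : 0 <= l ->
  (forall X, u \in X -> v \notin X ->
     l * (\sum_(i | uv i) d i) + \sum_(i | ~~ uv i && cuts E (E :&: out_cut X) s' t' i) d i
       <= \sum_(e in E :&: out_cut X) c e) ->
  cross_condition E u v s' t' (scale l).
Proof.
move=> l0 le_c X uX vX; apply: le_trans (le_c X uX vX).
rewrite (bigID uv) /= mulr_sumr; apply: lerD; apply: ler_sum_subpred => i.
- by move=> _; rewrite mulr_ge0 ?(com_ge0 com).
- by rewrite /scale => /andP[_ ->]; rewrite lexx.
- by move=> _; exact: com_ge0 com i.
- by rewrite /scale => /andP[-> /negPf ->]; rewrite lexx.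
Qed.

Lemma parallel_div l y i : d i * ((y == s i)%:R - (y == t i)%:R) =
  scale l i * ((y == s1 i)%:R - (y == t1 i)%:R) +
  scale (1 - l) i * ((y == s2 i)%:R - (y == t2 i)%:R).
Proof.
rewrite /scale /s1 /t1 /s2 /t2 /restrict /a1 /a2.
case: (uv i) => /=; first by ring.
by case: (in1 i) => /=; ring.
Qed.

Lemma parallel_routing : cross_condition (E1 :|: E2) u v s t d ->
  exists x, routing (E1 :|: E2) s t d x.
Proof.
case/parallel_ratio=> l [l0 l1 le1 le2]; have l0' : 0 <= 1 - l by rewrite subr_ge0.
have scaleE k i : ~~ uv i -> scale k i = d i by rewrite /scale => /negPf->.
have [x1 r1] := cs_routing cs1 (parallel_commodities tt1 a1P (scale_ge0 l0))
  (parallel_inner tt1 tt2 VI com a1P (scaleE l) inner) (scaled_cross l0 le1).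
have [x2 r2] := cs_routing cs2 (parallel_commodities tt2 a2P (scale_ge0 l0'))
  (parallel_inner tt2 tt1 VI' com' a2P (scaleE _) inner') (scaled_cross l0' le2).
by eexists; apply: routingU dE r1 r2 (parallel_div l).
Qed.

End Parallel.

Lemma cut_sufficient_parallel V1 V2 E1 E2 u v :
  two_terminal V1 E1 u v -> two_terminal V2 E2 u v -> [disjoint E1 & E2] ->
  V1 :&: V2 = [set u; v] -> cut_sufficient V1 E1 u v -> cut_sufficient V2 E2 u v ->
  cut_sufficient (V1 :|: V2) (E1 :|: E2) u v.
Proof.
move=> tt1 tt2 dE VI cs1 cs2; split=> s t d com inner.
  exact (parallel_slack tt1 tt2 dE VI cs1 cs2 com inner).
exact (parallel_routing tt1 tt2 dE VI cs1 cs2 com inner).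
Qed.

(** * Removal of loops and the induction *)

Definition loops : {set edge G} := [set e | arc_tail e == arc_head e].

(** A single arc may be a loop, so a component may collapse to one node with loops. In a series
    composition such a component adds only loops; in a parallel one, shared terminals make both
    sides collapse or neither. *)
Lemma series_parallel_cut_sufficient V E u v : (forall e, 0 <= c e) ->
  series_parallel_sub V E u v ->
  [/\ u = v, V = [set u] & E \subset loops] \/
  two_terminal V (E :\: loops) u v /\ cut_sufficient V (E :\: loops) u v.
Proof.
move=> c0; elim=> {V E u v}
  [e|V1 V2 E1 E2 u w v _ IH1 _ IH2 dE VI|V1 V2 E1 E2 u v _ IH1 _ IH2 dE VI].
- case: (eqVneq (arc_tail e) (arc_head e)) => te; [left | right].
    by split=> //; rewrite ?te ?setUid // sub1set inE te.
  have -> : [set e] :\: loops = [set e].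
    by apply/setDidPl; rewrite disjoints1 inE te.
  by split; [exact: two_terminal_arc | exact: cut_sufficient_arc].
- have dE' : [disjoint E1 :\: loops & E2 :\: loops].
    exact: disjointW (subsetDl _ _) (subsetDl _ _) dE.
  rewrite setDUl.
  case: IH1 => [[uw V1E L1]|[tt1 cs1]]; case: IH2 => [[wv V2E L2]|[tt2 cs2]].
  + left; split; rewrite ?uw //; last by rewrite subUset L1.
    by rewrite V1E V2E uw wv setUid.
  + right; have -> : E1 :\: loops = set0 by apply/eqP; rewrite setD_eq0.
    rewrite set0U V1E uw (setUidPr _) //; rewrite sub1set; exact: tt_start tt2.
  + right; have -> : E2 :\: loops = set0 by apply/eqP; rewrite setD_eq0.
    rewrite setU0 V2E -wv (setUidPl _) //; rewrite sub1set; exact: tt_end tt1.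
  + right; split; first exact: series_two_terminal tt1 tt2 VI.
    exact: cut_sufficient_series tt1 tt2 dE' VI cs1 cs2.
- have dE' : [disjoint E1 :\: loops & E2 :\: loops].
    exact: disjointW (subsetDl _ _) (subsetDl _ _) dE.
  rewrite setDUl.
  case: IH1 => [[uv V1E L1]|[tt1 cs1]]; case: IH2 => [[uv' V2E L2]|[tt2 cs2]].
  + by left; split; rewrite // ?V1E ?V2E ?setUid // subUset L1.
  + by have := tt_neq tt2; rewrite uv eqxx.
  + by have := tt_neq tt1; rewrite uv' eqxx.
  + right; split; first exact: parallel_two_terminal tt1 tt2.
    exact: cut_sufficient_parallel tt1 tt2 dE' VI cs1 cs2.
Qed.

End Routing.

(** * Necessity of the cut condition, and the equivalence *)

(** The net flow out of the set reachable from [s i] without [F] is [d i], and every arc leaving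
    this set belongs to [F]. *)
Lemma multiflow_cut (R : realType) (G : digraph) (k : nat) (s t : 'I_k -> node G)
    (d : 'I_k -> R) (x : edge G -> 'I_k -> R) (F : {set edge G}) i :
  s i != t i -> multiflow s t d x -> i \in separated s t F ->
  d i <= \sum_(e in F) x e i.
Proof.
move=> st [x0 div]; rewrite inE => sep.
pose A := [set y | has_path (~: F) (s i) y].
have sA : s i \in A by rewrite inE has_path_refl.
have tA : t i \notin A by rewrite inE.
have <- : \sum_(y in A) (\sum_(e | arc_tail e == y) x e i
                          - \sum_(e | arc_head e == y) x e i) = d i.
  under eq_bigr do rewrite div.
  rewrite (bigD1 (s i)) //= eqxx big1 ?addr0 // => y /andP[yA /negPf ->].
  by case: eqP => // yt; rewrite -yt yA in tA.
rewrite big_split /= sumrN.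
have sumA (g : edge G -> node G) :
    \sum_(y in A) \sum_(e | g e == y) x e i = \sum_(e | g e \in A) x e i.
  rewrite (exchange_big_dep (fun e => g e \in A)) /=; last by move=> y e yA /eqP->.
  apply: eq_bigr => e gA; rewrite (big_pred1 (g e)) // => y /=.
  by rewrite [g e == y]eq_sym; case: (y =P g e) => [->|_]; rewrite ?gA ?andbF.
rewrite !sumA lerBlDr; apply: ler_sum_predU => // e tailA.
rewrite -implyNb; apply/implyP => eF; rewrite inE in tailA; rewrite inE.
by apply: has_path_trans tailA (has_path_arc _); rewrite inE.
Qed.

Theorem theorem3 (R : realType) (G : digraph) (k : nat)
    (s t : 'I_k -> node G) (d : 'I_k -> R) (c : edge G -> R)
    (hG : series_parallel G)
    (hst : forall i, s i != t i)
    (hpath : forall i, has_path [set: edge G] (s i) (t i))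
    (hd : forall i, 0 < d i)
    (hc : forall e, 0 <= c e) :
  (exists X : edge G -> 'I_k -> R, multiflow s t d X /\ feasible c X) <->
  strengthened_cut_condition s t d c.
Proof.
split=> [[x [mf feas]] X|cut].
  apply: le_trans (ler_sum _ (fun e _ => feas e)).
  rewrite exchange_big /=; apply: ler_sum_subpred => [i _|i sep].
    by apply: sumr_ge0 => e _; case: mf.
  exact: multiflow_cut (hst i) mf sep.
have [u0 [v0 /(series_parallel_cut_sufficient 'I_k hc)]] := hG.
set E := setT :\: _; case=> [[uv VE _]|[tt cs]].
  (* The digraph has a single node, so distinct ends leave no commodity. *)
  have st (i : 'I_k) : False.
    have VP y : y = u0 by apply/set1P; rewrite -VE.
    by have := hst i; rewrite (VP (s i)) (VP (t i)) eqxx.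
  by exists (fun _ _ => 0); split; [split=> ? i|move=> e; rewrite big1 // => i]; case: (st i).
have pathE F x y : has_path (~: F) x y -> has_path (E :\: (E :&: F)) x y.
  apply: (@has_path_map _ _ _ id) => e; rewrite inE => eF.
  case: (eqVneq (arc_tail e) (arc_head e)) => [->|te]; first exact: has_path_refl.
  by apply: has_path_arc; rewrite !inE (negPf eF) te.
have cutE X : E :&: out_cut X = out_cut X.
  apply/setIidPr/subsetP=> e; rewrite !inE andbT => /andP[tX]; apply: contraNN.
  by move=> /eqP <-.
have com : commodities [set: node G] E s t d.
  split=> // i; first exact: ltW.
  by rewrite -(setD0 E) -(setI0 E); apply: pathE; rewrite setC0.
(* Loops affect neither out-cuts nor reachability, so this bound holds for every [X] and yields both
   the inner and the crossing condition. *)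
have cross X : \sum_(i | cuts E (E :&: out_cut X) s t i) d i
    <= \sum_(e in E :&: out_cut X) c e.
  rewrite [in leRHS]cutE; apply: le_trans (cut X).
  apply: ler_sum_subpred => i; first by move=> _; exact: ltW.
  by rewrite lexx inE andbT; apply: contra; exact: pathE.
have [||x [x0 div cap]] := cs_routing cs com.
- move=> X _; apply: le_trans (cross X); apply: ler_sum_subpred => [i _|i /andP[_ ->]].
    exact: ltW.
  exact: lexx.
- by move=> X _ _; exact: cross.
have sumE (P : pred (edge G)) i :
    \sum_(e | P e) (if e \in E then x e i else 0) = \sum_(e in E | P e) x e i.
  by rewrite -big_mkcondr; apply: eq_bigl => e; rewrite andbC.
(* Loops carry no flow. *)
exists (fun e i => if e \in E then x e i else 0); split; first split.
- by move=> e i; case: ifP => // eE; exact: x0.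
- move=> y i; rewrite !sumE div.
  case: eqP => [->|_]; first by rewrite (negPf (hst i)) subr0 mulr1.
  by case: eqP => _; rewrite ?subrr ?sub0r ?mulrN1 ?mulr0.
- move=> e; case: (boolP (e \in E)) => eE; first exact: cap.
  by rewrite big1.
Qed.
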